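(* Let $\mathbb{C}$ be a regular category. The following conditions are equivalent: (i) $\mathbb{C}$ is a Mal'tsev category; (ii) the Shifting Lemma holds in $\mathbb{C}$ when $R$ and $T$ are reflexive relations and $S$ is an equivalence relation; that is, for every object $X$ of $\mathbb{C}$, all reflexive relations $R,T$ on $X$ and every equivalence relation $S$ on $X$ with $R\wedge S\leqslant T$, whenever $x,y,u,v$ are (generalised) elements of $X$ with $(x,y)\in R\wedge T$, $(x,u)\in S$, $(y,v)\in S$ and $(u,v)\in R$, one has $(u,v)\in T$.
   Context: A category with finite limits is regular if every morphism factors as a regular epimorphism (a coequaliser of some parallel pair) followed by a monomorphism, and regular epimorphisms are stable under pullback. An (internal) relation $R$ from $X$ to $Y$ is a subobject $\langle r_1,r_2\rangle\colon R\rightarrowtail X\times Y$; a relation on $X$ is a relation from $X$ to $X$. For relations, $\leqslant$ denotes inclusion of subobjects and $\wedge$ denotes their intersection (meet of subobjects). For morphisms $x\colon A\to X$, $y\colon A\to Y$ with a common arbitrary domain $A$ (generalised elements), $(x,y)\in R$ means that $\langle x,y\rangle\colon A\to X\times Y$ factors through $R$. The opposite $R^\circ$ is the subobject $\langle r_2,r_1\rangle\colon R\rightarrowtail Y\times X$. For relations $R\rightarrowtail X\times Y$ and $S\rightarrowtail Y\times Z$ in a regular category, the composite $SR\rightarrowtail X\times Z$ (first $R$, then $S$) is the image, in the (regular epimorphism, monomorphism) factorization, of $\langle r_1\pi_1,s_2\pi_2\rangle\colon R\times_Y S\to X\times Z$, where $R\times_Y S$ is the pullback of $r_2$ and $s_1$.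 A relation $R$ on $X$ is reflexive if $1_X\leqslant R$, where $1_X$ is the diagonal $\langle 1_X,1_X\rangle\colon X\rightarrowtail X\times X$; symmetric if $R^\circ\leqslant R$; transitive if $RR\leqslant R$; and an equivalence relation if it is reflexive, symmetric and transitive. A finitely complete category $\mathbb{C}$ is a Mal'tsev category if every reflexive relation in $\mathbb{C}$ is an equivalence relation. *)

(* Defs.v *)
From mathcomp Require Import all_boot.

Set Implicit Arguments.
Unset Strict Implicit.
Unset Printing Implicit Defensive.

Declare Scope cat_scope.
Delimit Scope cat_scope with cat.
Local Open Scope cat_scope.

Record category := Category {
  ob :> Type;
  hom : ob -> ob -> Type;
  idm : forall X, hom X X;
  cmp : forall X Y Z, hom Y Z -> hom X Y -> hom X Z;
  cmp_idl : forall X Y (f : hom X Y), cmp (idm Y) f = f;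
  cmp_idr : forall X Y (f : hom X Y), cmp f (idm X) = f;
  cmpA : forall W X Y Z (h : hom Y Z) (g : hom X Y) (f : hom W X),
    cmp h (cmp g f) = cmp (cmp h g) f
}.
Arguments idm {c} X.

Notation "X ~> Y" := (hom X Y)
  (at level 99, Y at level 200, right associativity) : cat_scope.
(* [g ** f] is "first f, then g" *)
Notation "g ** f" := (cmp g f) (at level 40, left associativity) : cat_scope.

Section Morphisms.
Variable C : category.

Definition mono (X Y : C) (m : X ~> Y) : Prop :=
  forall (Z : C) (a b : Z ~> X), m ** a = m ** b -> a = b.

Definition is_coequaliser (K X Y : C) (a b : K ~> X) (q : X ~> Y) : Prop :=
  q ** a = q ** b /\
  forall (Z : C) (g : X ~> Z), g ** a = g ** b -> exists! h : Y ~> Z, h ** q = g.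

Definition regular_epi (X Y : C) (q : X ~> Y) : Prop :=
  exists (K : C) (a b : K ~> X), is_coequaliser a b q.

Definition is_pullback (X Y Z P : C) (f : X ~> Z) (g : Y ~> Z)
    (p : P ~> X) (q : P ~> Y) : Prop :=
  f ** p = g ** q /\
  forall (A : C) (a : A ~> X) (b : A ~> Y), f ** a = g ** b ->
    exists! h : A ~> P, p ** h = a /\ q ** h = b.

(* Finite diagrams are indexed by finite directed multigraphs; a functor on a
   finite category is such a diagram (one edge per arrow), with the same cones. *)
Record diagram := Diagram {
  vertex : finType;
  edge : finType;
  src : edge -> vertex;
  tgt : edge -> vertex;
  dob : vertex -> C;
  dmor : forall e : edge, dob (src e) ~> dob (tgt e)
}.

Record cone (D : diagram) := Cone {
  apex :> C;
  leg : forall v : vertex D, apex ~> dob v;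
  leg_nat : forall e : edge D, dmor e ** leg (src e) = leg (tgt e)
}.

Record limit (D : diagram) := Limit {
  limit_cone :> cone D;
  lift : forall K : cone D, K ~> limit_cone;
  lift_leg : forall (K : cone D) (v : vertex D),
    leg limit_cone v ** lift K = leg K v;
  lift_uniq : forall (K : cone D) (h : K ~> limit_cone),
    (forall v : vertex D, leg limit_cone v ** h = leg K v) -> h = lift K
}.

Record factorisation (X Y : C) (f : X ~> Y) := Factorisation {
  image_ob : C;
  image_epi : X ~> image_ob;
  image_mono : image_ob ~> Y;
  image_epiP : regular_epi image_epi;
  image_monoP : mono image_mono;
  image_fact : image_mono ** image_epi = f
}.

End Morphisms.

(* Limits and image factorisations are given by chosen ones. *)
Record fincomplete_category := FinComplete {
  fc_category :> category;
  lim : forall D : diagram fc_category, limit D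
}.

Record regular_category := Regular {
  reg_category :> fincomplete_category;
  factor : forall (X Y : reg_category) (f : X ~> Y), factorisation f;
  regular_epi_pullback :
    forall (X Y Z P : reg_category) (f : X ~> Z) (g : Y ~> Z)
      (p : P ~> X) (q : P ~> Y),
    is_pullback f g p q -> regular_epi f -> regular_epi q
}.

Section FiniteLimits.
Variable C : fincomplete_category.

Section Product.
Variables X Y : C.

Definition pair_diagram : diagram C :=
  @Diagram C bool void (fun e => match e with end) (fun e => match e with end)
    (fun b => if b then X else Y) (fun e => match e with end).

Definition prod_ob : C := lim pair_diagram.
Definition pr1 : prod_ob ~> X := leg (lim pair_diagram) true.
Definition pr2 : prod_ob ~> Y := leg (lim pair_diagram) false.

Definition pair_cone (A : C) (x : A ~> X) (y : A ~> Y) : cone pair_diagram :=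
  @Cone C pair_diagram A
    (fun b => match b return A ~> (if b then X else Y) with
              | true => x | false => y end)
    (fun e => match e with end).

Definition pairing (A : C) (x : A ~> X) (y : A ~> Y) : A ~> prod_ob :=
  lift (lim pair_diagram) (pair_cone x y).

Lemma pr1_pairing (A : C) (x : A ~> X) (y : A ~> Y) : pr1 ** pairing x y = x.
Proof. exact: (lift_leg (lim pair_diagram) (pair_cone x y) true). Qed.

Lemma pr2_pairing (A : C) (x : A ~> X) (y : A ~> Y) : pr2 ** pairing x y = y.
Proof. exact: (lift_leg (lim pair_diagram) (pair_cone x y) false). Qed.

Lemma prod_ext (A : C) (h k : A ~> prod_ob) :
  pr1 ** h = pr1 ** k -> pr2 ** h = pr2 ** k -> h = k.
Proof.
move=> e1 e2; rewrite (@lift_uniq _ _ _ (pair_cone (pr1 ** k) (pr2 ** k)) h).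
  by apply/esym/(@lift_uniq _ _ _ (pair_cone (pr1 ** k) (pr2 ** k))); case.
by case.
Qed.

End Product.

Section Pullback.
Variables (X Y Z : C) (f : X ~> Z) (g : Y ~> Z).

Definition cospan_ob (v : option bool) : C :=
  match v with None => Z | Some true => X | Some false => Y end.

Definition cospan_diagram : diagram C :=
  @Diagram C (option bool) bool Some (fun=> None) cospan_ob
    (fun b => match b return cospan_ob (Some b) ~> Z with
              | true => f | false => g end).

Definition pb_ob : C := lim cospan_diagram.
Definition pb1 : pb_ob ~> X := leg (lim cospan_diagram) (Some true).
Definition pb2 : pb_ob ~> Y := leg (lim cospan_diagram) (Some false).

Lemma pbE : f ** pb1 = g ** pb2.
Proof.
exact: (etrans (leg_nat (lim cospan_diagram) true)
               (esym (leg_nat (lim cospan_diagram) false))).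
Qed.

Definition pb_cone (A : C) (a : A ~> X) (b : A ~> Y) (e : f ** a = g ** b) :
    cone cospan_diagram :=
  @Cone C cospan_diagram A
    (fun v => match v return A ~> cospan_ob v with
              | None => f ** a | Some true => a | Some false => b end)
    (fun c => match c with true => erefl | false => esym e end).

Lemma pb_ext (A : C) (h k : A ~> pb_ob) :
  pb1 ** h = pb1 ** k -> pb2 ** h = pb2 ** k -> h = k.
Proof.
move=> e1 e2.
have e : f ** (pb1 ** k) = g ** (pb2 ** k) by rewrite !cmpA pbE.
have legN : leg (lim cospan_diagram) None = f ** pb1.
  exact: (esym (leg_nat (lim cospan_diagram) true)).
rewrite (@lift_uniq _ _ _ (pb_cone e) h).
  apply/esym/(@lift_uniq _ _ _ (pb_cone e)) => -[[]|] //=.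
  by rewrite legN -cmpA.
by case=> [[]|] //=; rewrite legN -cmpA e1.
Qed.

Lemma pbP : is_pullback f g pb1 pb2.
Proof.
split=> [|A a b e]; first exact: pbE.
exists (lift (lim cospan_diagram) (pb_cone e)).
have l1 := lift_leg (lim cospan_diagram) (pb_cone e) (Some true).
have l2 := lift_leg (lim cospan_diagram) (pb_cone e) (Some false).
split=> [|h [h1 h2]]; first by split.
by apply: pb_ext; [rewrite h1 | rewrite h2].
Qed.

End Pullback.

(* A subobject is represented by a monomorphism; equality of subobjects is
   [sub_le] in both directions. *)
Record subobject (A : C) := Subobject {
  sub_ob : C;
  sub_mor : sub_ob ~> A;
  sub_mono : mono sub_mor
}.

Definition sub_le (A : C) (S T : subobject A) : Prop :=
  exists h : sub_ob S ~> sub_ob T, sub_mor T ** h = sub_mor S.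

Section Meet.
Variables (A : C) (S T : subobject A).

Lemma meet_mono : mono (sub_mor S ** pb1 (sub_mor S) (sub_mor T)).
Proof.
move=> Z a b; rewrite -!cmpA => e; have e1 := @sub_mono _ S _ _ _ e.
apply: pb_ext => //; apply: (@sub_mono _ T).
by rewrite !cmpA -pbE -!cmpA e1.
Qed.

Definition sub_meet : subobject A := Subobject meet_mono.

End Meet.

Definition relation (X Y : C) := subobject (prod_ob X Y).

Section Relation.
Variables X Y : C.

Definition rel1 (R : relation X Y) : sub_ob R ~> X := pr1 X Y ** sub_mor R.
Definition rel2 (R : relation X Y) : sub_ob R ~> Y := pr2 X Y ** sub_mor R.

Definition in_rel (A : C) (x : A ~> X) (y : A ~> Y) (R : relation X Y) : Prop :=
  exists h : A ~> sub_ob R, sub_mor R ** h = pairing x y.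

Lemma opp_mono (R : relation X Y) : mono (pairing (rel2 R) (rel1 R)).
Proof.
move=> Z a b e; apply: (@sub_mono _ R); apply: prod_ext; rewrite !cmpA.
- by rewrite -/(rel1 R) -(pr2_pairing (rel2 R) (rel1 R)) -!cmpA e.
- by rewrite -/(rel2 R) -(pr1_pairing (rel2 R) (rel1 R)) -!cmpA e.
Qed.

Definition rel_opp (R : relation X Y) : relation Y X := Subobject (@opp_mono R).

End Relation.

Lemma diag_mono (X : C) : mono (pairing (idm X) (idm X)).
Proof.
move=> Z a b /(congr1 (cmp (pr1 X X))).
by rewrite !cmpA pr1_pairing !cmp_idl.
Qed.

Definition rel_diag (X : C) : relation X X := Subobject (@diag_mono X).

End FiniteLimits.

Section Regular.
Variable C : regular_category.

(* The composite SR: first R, then S. *)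
Definition rel_comp (X Y Z : C) (S : relation Y Z) (R : relation X Y) :
    relation X Z :=
  Subobject (@image_monoP _ _ _ _ (factor
    (pairing (rel1 R ** pb1 (rel2 R) (rel1 S)) (rel2 S ** pb2 (rel2 R) (rel1 S))))).

Definition reflexive_rel (X : C) (R : relation X X) : Prop :=
  sub_le (rel_diag X) R.
Definition symmetric_rel (X : C) (R : relation X X) : Prop :=
  sub_le (rel_opp R) R.
Definition transitive_rel (X : C) (R : relation X X) : Prop :=
  sub_le (rel_comp R R) R.

Definition equivalence_rel (X : C) (R : relation X X) : Prop :=
  [/\ reflexive_rel R, symmetric_rel R & transitive_rel R].

Definition maltsev : Prop :=
  forall (X : C) (R : relation X X), reflexive_rel R -> equivalence_rel R.

End Regular.

(* Main.v *)
From mathcomp Require Import all_boot.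
Require Import Defs.

(** The argument is carried out with generalised elements: inclusions between
    relations, and reflexivity, symmetry and transitivity, are all detected on
    them ([in_rel_le], [reflexive_relP], [symmetric_relP], [transitive_relP]).
    Only composites need care: a generalised element of a composite has a
    middle point merely after restriction along a regular epimorphism
    ([in_rel_compP]).  This does no harm, since membership in a relation
    descends along regular epimorphisms ([in_rel_descent]).

    If the category is Mal'tsev, then any two equivalence relations [E] and [S]
    permute, because their composite is reflexive, hence symmetric
    ([maltsev_permute]).  Let [x], [y], [u], [v] be as in the Shifting Lemma.
    From [u S x] and [x (R /\ T) y], permutability gives, locally, a point [w]
    with [u (R /\ T) w] and [w S y].  Then [w] and [v] are related by both [S]
    (through [y]) and [R] (through [u]), hence by [T]; so [u T w T v].

    Conversely, given a reflexive relation [E] on [X], apply the Shifting Lemma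
    on the object [E] of pairs: let [S] relate two pairs with the same second
    component, let [(a, b) T (c, d)] mean [a E d], and let [R] be the total
    relation.  Then [S <= T], so that the Shifting Lemma says that [T] is
    invariant under [S] on both sides.  This yields that [a E b], [c E b],
    [c E d] imply [a E d] ([shifting_difunctional]); a reflexive relation with
    this property is symmetric and transitive. *)

Set Implicit Arguments.
Unset Strict Implicit.
Unset Printing Implicit Defensive.

Local Open Scope cat_scope.

(** A regular epimorphism is a strong epimorphism. *)
Lemma regular_epi_strong (C : category) (W X Y Z : C) (q : X ~> Y)
    (m : W ~> Z) (h : X ~> W) (g : Y ~> Z) :
  regular_epi q -> mono m -> m ** h = g ** q ->
  exists k : Y ~> W, m ** k = g.
Proof.
case=> K [a [b [qab q_univ]]] m_mono sq.
have hab : h ** a = h ** b by apply: m_mono; rewrite !cmpA sq -!cmpA qab.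
have [k [kq _]] := q_univ _ _ hab; exists k.
have gqab : (g ** q) ** a = (g ** q) ** b by rewrite -!cmpA qab.
have [l [_ l_uniq]] := q_univ _ _ gqab.
by rewrite -(l_uniq g erefl) -(l_uniq (m ** k)) // -cmpA kq.
Qed.

Section Elements.
Variable C : fincomplete_category.

Lemma pairing_comp (X Y A B : C) (x : A ~> X) (y : A ~> Y) (p : B ~> A) :
  pairing x y ** p = pairing (x ** p) (y ** p).
Proof.
by apply: prod_ext; rewrite cmpA ?pr1_pairing ?pr2_pairing.
Qed.

Lemma pairing_inj (X Y A : C) (x x' : A ~> X) (y y' : A ~> Y) :
  pairing x y = pairing x' y' -> x = x' /\ y = y'.
Proof.
move=> e; split.
- by rewrite -(pr1_pairing x y) e pr1_pairing.
- by rewrite -(pr2_pairing x y) e pr2_pairing.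
Qed.

Lemma rel_pairing (X Y : C) (R : relation X Y) :
  sub_mor R = pairing (rel1 R) (rel2 R).
Proof. by apply: prod_ext; rewrite ?pr1_pairing ?pr2_pairing. Qed.

Lemma in_relP (X Y A : C) (x : A ~> X) (y : A ~> Y) (R : relation X Y) :
  in_rel x y R <-> exists h : A ~> sub_ob R, rel1 R ** h = x /\ rel2 R ** h = y.
Proof.
rewrite /in_rel rel_pairing; split=> -[h].
- by rewrite pairing_comp => /pairing_inj e; exists h.
- by case=> <- <-; exists h; rewrite pairing_comp.
Qed.

Lemma in_rel_generic (X Y : C) (R : relation X Y) : in_rel (rel1 R) (rel2 R) R.
Proof. by apply/in_relP; exists (idm _); rewrite !cmp_idr. Qed.

Lemma in_rel_comp_arrow (X Y A B : C) (x : A ~> X) (y : A ~> Y)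
    (R : relation X Y) (p : B ~> A) :
  in_rel x y R -> in_rel (x ** p) (y ** p) R.
Proof. by case=> h e; exists (h ** p); rewrite cmpA e pairing_comp. Qed.

Lemma in_rel_le (X Y : C) (R S : relation X Y) :
  sub_le R S <->
  forall (A : C) (x : A ~> X) (y : A ~> Y), in_rel x y R -> in_rel x y S.
Proof.
split=> [[k e] A x y [h eh]|RS].
  by exists (k ** h); rewrite cmpA e.
by rewrite /sub_le (rel_pairing R); apply/RS/in_rel_generic.
Qed.

Lemma in_rel_meet (X Y A : C) (x : A ~> X) (y : A ~> Y) (R S : relation X Y) :
  in_rel x y (sub_meet R S) <-> in_rel x y R /\ in_rel x y S.
Proof.
split=> [[h /= e]|[[h eh] [k ek]]].
  split; [exists (pb1 (sub_mor R) (sub_mor S) ** h)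
         |exists (pb2 (sub_mor R) (sub_mor S) ** h)]; rewrite cmpA //.
  by rewrite -pbE.
have [_ univ] := pbP (sub_mor R) (sub_mor S).
have [l [[e1 _] _]] := univ A h k (etrans eh (esym ek)).
by exists l; rewrite /= -cmpA e1.
Qed.

Lemma in_rel_diag (X A : C) (x y : A ~> X) : in_rel x y (rel_diag X) <-> x = y.
Proof.
split=> [[h /=]|->].
  by rewrite pairing_comp !cmp_idl => /pairing_inj[<- <-].
by exists y; rewrite /= pairing_comp !cmp_idl.
Qed.

Lemma in_rel_opp (X Y A : C) (x : A ~> X) (y : A ~> Y) (R : relation X Y) :
  in_rel y x (rel_opp R) <-> in_rel x y R.
Proof.
split=> [[h /=]|/in_relP[h [<- <-]]].
  by rewrite pairing_comp => /pairing_inj e; apply/in_relP; exists h; case: e.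
by exists h; rewrite /= pairing_comp.
Qed.

Lemma idm_mono (X : C) : mono (idm X).
Proof. by move=> Z a b; rewrite !cmp_idl. Qed.

Definition rel_total (X Y : C) : relation X Y := Subobject (@idm_mono _).

Lemma in_rel_total (X Y A : C) (x : A ~> X) (y : A ~> Y) :
  in_rel x y (rel_total X Y).
Proof. by exists (pairing x y); rewrite /= cmp_idl. Qed.

Section Preimage.
Variables (X Y X' Y' : C) (f : X' ~> X) (g : Y' ~> Y) (R : relation X Y).

Let fg := pairing (f ** pr1 X' Y') (g ** pr2 X' Y').

Lemma preim_mono : mono (pb1 fg (sub_mor R)).
Proof.
move=> Z a b e; apply: pb_ext => //; apply: (@sub_mono _ _ R).
by rewrite !cmpA -pbE -!cmpA e.
Qed.

Definition rel_preim : relation X' Y' := Subobject preim_mono.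

Lemma in_rel_preim (A : C) (x : A ~> X') (y : A ~> Y') :
  in_rel x y rel_preim <-> in_rel (f ** x) (g ** y) R.
Proof.
have fgE : fg ** pairing x y = pairing (f ** x) (g ** y).
  by rewrite pairing_comp -!cmpA pr1_pairing pr2_pairing.
split=> [[h /= e]|[h e]].
  by exists (pb2 fg (sub_mor R) ** h); rewrite cmpA -pbE -cmpA e.
have [_ univ] := pbP fg (sub_mor R).
have [l [[e1 _] _]] := univ A (pairing x y) h (etrans fgE (esym e)).
by exists l.
Qed.

End Preimage.

End Elements.

Section RegularCategory.
Variable C : regular_category.

Lemma in_rel_descent (X Y A B : C) (x : A ~> X) (y : A ~> Y) (R : relation X Y)
    (q : B ~> A) :
  regular_epi q -> in_rel (x ** q) (y ** q) R -> in_rel x y R.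
Proof.
move=> q_epi [h e]; rewrite -pairing_comp in e.
exact: regular_epi_strong q_epi (@sub_mono _ _ R) e.
Qed.

Lemma in_rel_comp (X Y Z A : C) (R : relation X Y) (S : relation Y Z)
    (x : A ~> X) (y : A ~> Y) (z : A ~> Z) :
  in_rel x y R -> in_rel y z S -> in_rel x z (rel_comp S R).
Proof.
move=> /in_relP[h [<- hy]] /in_relP[k [ky <-]].
have [_ univ] := pbP (rel2 R) (rel1 S).
have [l [[<- <-] _]] := univ A h k (etrans hy (esym ky)).
by exists (image_epi (factor _) ** l); rewrite /= cmpA image_fact pairing_comp -!cmpA.
Qed.

(** The cover is the pullback, along the given element, of the regular
    epimorphism onto the image that defines the composite. *)
Lemma in_rel_compP (X Y Z A : C) (R : relation X Y) (S : relation Y Z)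
    (x : A ~> X) (z : A ~> Z) :
  in_rel x z (rel_comp S R) ->
  exists (B : C) (q : B ~> A) (y : B ~> Y),
    [/\ regular_epi q, in_rel (x ** q) y R & in_rel y (z ** q) S].
Proof.
pose F := factor (pairing (rel1 R ** pb1 (rel2 R) (rel1 S))
                          (rel2 S ** pb2 (rel2 R) (rel1 S))).
case=> h; rewrite /= -/F => hE.
pose q := pb2 (image_epi F) h; pose w := pb1 (image_epi F) h.
pose r := pb1 (rel2 R) (rel1 S) ** w; pose s := pb2 (rel2 R) (rel1 S) ** w.
have [xq zq] : rel1 R ** r = x ** q /\ rel2 S ** s = z ** q.
  apply: pairing_inj; rewrite -pairing_comp -hE -cmpA -pbE cmpA image_fact.
  by rewrite pairing_comp -!cmpA.
have rs : rel1 S ** s = rel2 R ** r by rewrite /r /s !cmpA pbE.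
exists _, q, (rel2 R ** r); split.
- exact: regular_epi_pullback (pbP _ _) (image_epiP F).
- by apply/in_relP; exists r.
- by apply/in_relP; exists s.
Qed.

Lemma reflexive_relP (X : C) (R : relation X X) :
  reflexive_rel R <-> forall (A : C) (x : A ~> X), in_rel x x R.
Proof.
split=> [/in_rel_le le A x|Rxx]; first exact/le/in_rel_diag.
by apply/in_rel_le => A x y /in_rel_diag->.
Qed.

Lemma symmetric_relP (X : C) (R : relation X X) :
  symmetric_rel R <->
  forall (A : C) (x y : A ~> X), in_rel x y R -> in_rel y x R.
Proof.
split=> [/in_rel_le le A x y Rxy|sym]; first exact/le/in_rel_opp.
by apply/in_rel_le => A x y /in_rel_opp/sym.
Qed.

Lemma transitive_relP (X : C) (R : relation X X) :
  transitive_rel R <->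
  forall (A : C) (x y z : A ~> X),
    in_rel x y R -> in_rel y z R -> in_rel x z R.
Proof.
split=> [/in_rel_le le A x y z Rxy Ryz|trans].
  exact/le/(in_rel_comp Rxy Ryz).
apply/in_rel_le => A x z /in_rel_compP[B [q [y [q_epi Rxy Ryz]]]].
exact: in_rel_descent q_epi (trans _ _ _ _ Rxy Ryz).
Qed.

Lemma equivalence_preim_diag (X Y : C) (f : X ~> Y) :
  equivalence_rel (rel_preim f f (rel_diag Y)).
Proof.
split.
- by apply/reflexive_relP => A x; apply/in_rel_preim/in_rel_diag.
- apply/symmetric_relP => A x y /in_rel_preim/in_rel_diag e.
  exact/in_rel_preim/in_rel_diag.
- apply/transitive_relP => A x y z /in_rel_preim/in_rel_diag e.
  move=> /in_rel_preim/in_rel_diag e'.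
  by apply/in_rel_preim/in_rel_diag; rewrite e.
Qed.

(** Reversing the two given instances puts [(z, x)] in the composite of [E]
    followed by [S], a reflexive relation; its symmetry returns [(x, z)]. *)
Lemma maltsev_permute (X A : C) (E S : relation X X) (x y z : A ~> X) :
  maltsev C -> reflexive_rel E -> reflexive_rel S ->
  in_rel x y S -> in_rel y z E -> in_rel x z (rel_comp S E).
Proof.
move=> mal Erefl Srefl Sxy Eyz.
have [_ /symmetric_relP Esym _] := mal _ _ Erefl.
have [_ /symmetric_relP Ssym _] := mal _ _ Srefl.
have SErefl : reflexive_rel (rel_comp S E).
  apply/reflexive_relP => B w.
  by apply: (in_rel_comp (y := w)); apply: (reflexive_relP _).1.
have [_ /symmetric_relP sym _] := mal _ _ SErefl.
by apply: sym; apply: in_rel_comp (Esym _ _ _ Eyz) (Ssym _ _ _ Sxy).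
Qed.

Definition shifting_lemma : Prop :=
  forall (X : C) (R S T : relation X X),
    reflexive_rel R -> reflexive_rel T -> equivalence_rel S ->
    sub_le (sub_meet R S) T ->
    forall (A : C) (x y u v : A ~> X),
      in_rel x y (sub_meet R T) -> in_rel x u S -> in_rel y v S ->
      in_rel u v R -> in_rel u v T.

Lemma maltsev_shifting : maltsev C -> shifting_lemma.
Proof.
move=> mal X R S T Rrefl Trefl [Srefl Ssym Strans] RST A x y u v xyRT xuS yvS uvR.
have [_ /symmetric_relP Rsym /transitive_relP Rtrans] := mal _ _ Rrefl.
have [_ _ /transitive_relP Ttrans] := mal _ _ Trefl.
move/symmetric_relP: Ssym => Ssym; move/transitive_relP: Strans => Strans.
have RTrefl : reflexive_rel (sub_meet R T).
  by apply/reflexive_relP => B w; apply/in_rel_meet; split; apply: (reflexive_relP _).1.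
have := maltsev_permute mal RTrefl Srefl (Ssym _ _ _ xuS) xyRT.
case/in_rel_compP=> B [q [w [q_epi /in_rel_meet[uwR uwT] wyS]]].
apply: in_rel_descent q_epi (Ttrans _ _ w _ uwT _).
move/in_rel_le: RST; apply; apply/in_rel_meet; split.
- exact: Rtrans _ _ _ _ (Rsym _ _ _ uwR) (in_rel_comp_arrow q uvR).
- exact: Strans _ _ _ _ wyS (in_rel_comp_arrow q yvS).
Qed.

(** The Shifting Lemma is applied to the pairs [(c, b)], [(c, d)], [(a, b)],
    [(c, d)] as [x], [y], [u], [v]. *)
Lemma shifting_difunctional (X A : C) (E : relation X X) (a b c d : A ~> X) :
  shifting_lemma ->
  in_rel a b E -> in_rel c b E -> in_rel c d E -> in_rel a d E.
Proof.
move=> shift /in_relP[u [ua ub]] /in_relP[x [xc xb]] /in_relP[v [vc vd]].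
pose S := rel_preim (rel2 E) (rel2 E) (rel_diag X).
pose T := rel_preim (rel1 E) (rel2 E) E.
have Trefl : reflexive_rel T.
  by apply/reflexive_relP => B p; apply/in_rel_preim/in_relP; exists p.
have ST : sub_le (sub_meet (rel_total _ _) S) T.
  apply/in_rel_le => B p q /in_rel_meet[_ /in_rel_preim/in_rel_diag pq].
  by apply/in_rel_preim; rewrite -pq; apply/in_relP; exists p.
have Rrefl : reflexive_rel (rel_total (sub_ob E) (sub_ob E)).
  by apply/reflexive_relP => B p; apply: in_rel_total.
have /in_rel_preim : in_rel u v T; last by rewrite ua vd.
apply: (shift _ _ _ _ Rrefl Trefl (equivalence_preim_diag (rel2 E)) ST _ x v).
- apply/in_rel_meet; split; first exact: in_rel_total.
  by apply/in_rel_preim/in_relP; exists v; rewrite xc.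
- by apply/in_rel_preim/in_rel_diag; rewrite xb.
- exact/in_rel_preim/in_rel_diag.
- exact: in_rel_total.
Qed.

Lemma shifting_maltsev : shifting_lemma -> maltsev C.
Proof.
move=> shift X E Erefl; split=> //; move/reflexive_relP: Erefl => Erefl.
- apply/symmetric_relP => A x y Exy.
  exact: shifting_difunctional shift (Erefl _ y) Exy (Erefl _ x).
- apply/transitive_relP => A x y z Exy Eyz.
  exact: shifting_difunctional shift Exy (Erefl _ y) Eyz.
Qed.

End RegularCategory.

Theorem corollary2p3 (C : regular_category) :
  maltsev C <->
  (forall (X : C) (R S T : relation X X),
     reflexive_rel R -> reflexive_rel T -> equivalence_rel S ->
     sub_le (sub_meet R S) T ->
     forall (A : C) (x y u v : hom A X),
       in_rel x y (sub_meet R T) -> in_rel x u S -> in_rel y v S ->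
       in_rel u v R ->
       in_rel u v T).
Proof. by split; [apply: maltsev_shifting | apply: shifting_maltsev]. Qed.
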